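(* For $n\ge1$ let $C_n$ be the circumscribed circle of the right triangle with legs $\sqrt{F_n}$, $\sqrt{F_{n+1}}$ and hypotenuse $\sqrt{F_{n+2}}$. Then the area of $C_n$ is $\frac{\pi}{4}F_{n+2}$ and the perimeter of $C_n$ is $\pi\sqrt{F_{n+2}}$.
   Context: $F_n$ denotes the $n$-th Fibonacci number: $F_1=F_2=1$ and $F_{n+1}=F_n+F_{n-1}$ for $n\ge 2$. The circumscribed circle of a triangle is the circle passing through its three vertices; its area is that of the disc it bounds. The triangles in question are the triangles $\Delta_n$ of the Fibonacci--Theodorus spiral. *)

(* Defs.v *)
From HB Require Import structures.
From mathcomp Require Export all_boot all_order all_algebra.
From mathcomp Require Export all_classical all_reals all_analysis.
Export Order.TTheory GRing.Theory Num.Theory.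
Export numFieldNormedType.Exports.

Set Implicit Arguments.
Unset Strict Implicit.
Unset Printing Implicit Defensive.

Local Open Scope classical_set_scope.
Local Open Scope ring_scope.

Fixpoint fib (n : nat) : nat :=
  match n with
  | 0 => 0
  | 1 => 1
  | (m.+1 as k).+1 => fib k + fib m
  end%N.

(* The library norm on R * R is the max norm, hence the explicit Euclidean
   distance on the plane. *)
Definition edist (R : realType) (P Q : R * R) : R :=
  Num.sqrt ((P.1 - Q.1) ^+ 2 + (P.2 - Q.2) ^+ 2).

Definition right_angle (R : realType) (A P B : R * R) : Prop :=
  (A.1 - P.1) * (B.1 - P.1) + (A.2 - P.2) * (B.2 - P.2) = 0.

(* P is the vertex of the right angle. *)
Definition right_triangle (R : realType) (A P B : R * R) (a b c : R) : Prop :=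
  [/\ 0 < a /\ 0 < b, right_angle A P B,
      edist P A = a, edist P B = b & edist A B = c].

Record circle (R : realType) := Circle {
  center : R * R;
  radius : R;
  radius_gt0 : 0 < radius }.

Definition circle_set (R : realType) (C : circle R) : set (R * R) :=
  [set Q | edist (center C) Q = radius C].

Definition disc (R : realType) (C : circle R) : set (R * R) :=
  [set Q | edist (center C) Q <= radius C].

Definition circumscribed (R : realType) (A B P : R * R) (C : circle R) : Prop :=
  [/\ circle_set C A, circle_set C B & circle_set C P].

Definition area (R : realType) (S : set (R * R)) : \bar R :=
  (@lebesgue_measure R \x @lebesgue_measure R)%E S.

Definition polygonal_length (R : realType) (gamma : R -> R * R)
    (a : R) (s : seq R) : R :=
  \sum_(0 <= i < size s)
    edist (gamma (nth a (a :: s) i)) (gamma (nth a (a :: s) i.+1)).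

Definition arc_length (R : realType) (a b : R) (gamma : R -> R * R) : \bar R :=
  ereal_sup [set (polygonal_length gamma a s)%:E | s in itv_partition a b].

Definition simple_closed_param (R : realType) (a b : R) (gamma : R -> R * R)
    (S : set (R * R)) : Prop :=
  [/\ a < b, {within `[a, b], continuous gamma}, gamma a = gamma b,
      {in `[a, b[ &, injective gamma} & gamma @` `[a, b] = S].

(* The perimeter of a simple closed curve does not depend on the choice of its
   simple closed parametrization. *)
Definition has_perimeter (R : realType) (S : set (R * R)) (l : \bar R) : Prop :=
  exists (a b : R) (gamma : R -> R * R),
    simple_closed_param a b gamma S /\ arc_length a b gamma = l.

(* Main.v *)
(* By Thales the circumscribed circle is centred at the midpoint of the
   hypotenuse and has radius r = sqrt F_(n+2) / 2.  The area of its disc is the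
   integral of the chord lengths 2 sqrt (r^2 - x^2), computed with the
   substitution x = r sin t.  A chord of the circle spanning the angle t has
   length 2 r |sin (t / 2)|, so sin x <= x bounds every inscribed polygonal
   length by 2 pi r, and x cos x <= sin x shows that regular polygons reach it
   in the limit. *)
Require Import Defs.
From mathcomp Require Import ring lra.

Set Implicit Arguments.
Unset Strict Implicit.
Unset Printing Implicit Defensive.

Local Open Scope classical_set_scope.
Local Open Scope ring_scope.

(** * Squared form of distance equations, equality of circles *)

Lemma edist_eqP {R : realType} {P Q : R * R} {d : R} : 0 <= d ->
  edist P Q = d <-> (P.1 - Q.1) ^+ 2 + (P.2 - Q.2) ^+ 2 = d ^+ 2.
Proof.
move=> d0; split=> [<-|h]; last by rewrite /edist h sqrtr_sqr ger0_norm.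
by rewrite sqr_sqrtr// addr_ge0// sqr_ge0.
Qed.

Lemma edist_leP (R : realType) (P Q : R * R) (d : R) : 0 <= d ->
  (edist P Q <= d) = ((P.1 - Q.1) ^+ 2 + (P.2 - Q.2) ^+ 2 <= d ^+ 2).
Proof.
by move=> d0; rewrite -[in LHS](ger0_norm d0) -sqrtr_sqr ler_sqrt// sqr_ge0.
Qed.

(** The positivity field of a circle is a boolean equation, so any two proofs of it coincide. *)
Lemma circle_eq (R : realType) (C D : circle R) :
  center C = center D -> radius C = radius D -> C = D.
Proof.
case: C D => [c r r0] [d s s0] /= cd rs; move: cd rs r0 s0 => -> -> r0 s0.
by rewrite (bool_irrelevance r0 s0).
Qed.

(** * The circumscribed circle of a right triangle *)

Section right_triangle.
Context (R : realType) (A P B : R * R) (a b c : R).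
Hypothesis hT : right_triangle A P B a b c.

(** The two sides differ by -2 times the inner product of the legs, which the right angle makes
    zero. *)
Lemma pythagoras : c ^+ 2 = a ^+ 2 + b ^+ 2.
Proof.
case: hT => -[a0 b0]; rewrite /right_angle => h PA PB AB.
have c0 : 0 <= c by rewrite -AB sqrtr_ge0.
move/edist_eqP : AB => /(_ c0) <-; move/edist_eqP : PA => /(_ (ltW a0)) <-.
move/edist_eqP : PB => /(_ (ltW b0)) <-.
by apply/eqP; rewrite -subr_eq0; apply/eqP; rewrite -[RHS](mulr0 (-2)) -h; ring.
Qed.

Lemma hypotenuse_gt0 : 0 < c.
Proof.
have [[a0 b0] _ _ _ AB] := hT.
have : 0 < c ^+ 2 by rewrite pythagoras addr_gt0// exprn_gt0.
have : 0 <= c by rewrite -AB sqrtr_ge0.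
by rewrite le_eqVlt => /predU1P[<-|//]; rewrite expr0n ltxx.
Qed.

Lemma circumradius_gt0 : 0 < c / 2.
Proof. by rewrite divr_gt0// hypotenuse_gt0. Qed.

Definition circumcircle : circle R :=
  Circle ((A.1 + B.1) / 2, (A.2 + B.2) / 2) circumradius_gt0.

Lemma circumscribed_circumcircle : circumscribed A B P circumcircle.
Proof.
have c20 := ltW circumradius_gt0.
have [_ h _ _ /(edist_eqP (ltW hypotenuse_gt0)) AB] := hT.
rewrite /right_angle in h.
split; rewrite /circle_set/=; apply/(edist_eqP c20) => /=.
- by rewrite expr_div_n -AB; field.
- by rewrite expr_div_n -AB; field.
(* At [P] the squared distance to the midpoint exceeds a quarter of the squared hypotenuse by
   exactly the inner product in [h]. *)
- by rewrite expr_div_n -AB -[LHS]subr0 -h; field.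
Qed.

(* Subtracting the equations of the circle at the vertices shows that the
   offset of the centre from the midpoint of the hypotenuse is orthogonal to
   both legs. *)
Lemma circumscribed_unique (C : circle R) :
  circumscribed A B P C -> circumcircle = C.
Proof.
have [[a0 b0] h /(edist_eqP (ltW a0)) PA /(edist_eqP (ltW b0)) PB _] := hT.
have [/(edist_eqP (ltW circumradius_gt0)) CA _ _] :=
  circumscribed_circumcircle.
case: C => -[x y] r r0 [].
move=> /(edist_eqP (ltW r0))/= + /(edist_eqP (ltW r0))/= +
  /(edist_eqP (ltW r0))/=.
move: CA h PA PB; rewrite /right_angle/=.
move=> CA h PA PB DA DB DP.
pose u1 := A.1 - P.1; pose u2 := A.2 - P.2.
pose v1 := B.1 - P.1; pose v2 := B.2 - P.2.
pose d1 := x - (A.1 + B.1) / 2; pose d2 := y - (A.2 + B.2) / 2.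
have du : d1 * u1 + d2 * u2 = 0.
  rewrite -[RHS](mul0r (1/2)) -(subrr (r ^+ 2)) -{1}DP -DA -[LHS]subr0.
  by rewrite -(mulr0 (-1/2)) -h /d1 /d2 /u1 /u2; field.
have dv : d1 * v1 + d2 * v2 = 0.
  rewrite -[RHS](mul0r (1/2)) -(subrr (r ^+ 2)) -{1}DP -DB -[LHS]subr0.
  by rewrite -(mulr0 (-1/2)) -h /d1 /d2 /v1 /v2; field.
(* By Lagrange's identity the square of this determinant plus the square of the vanishing inner
   product is [a ^+ 2 * b ^+ 2]. *)
have det0 : u1 * v2 - u2 * v1 != 0.
  rewrite -sqrf_eq0.
  suff -> : (u1 * v2 - u2 * v1) ^+ 2 = a ^+ 2 * b ^+ 2.
    by rewrite mulf_neq0// sqrf_eq0 gt_eqF.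
  rewrite -PA -PB -[LHS]addr0 -(mulr0 (u1 * v1 + u2 * v2)) -[in LHS]h.
  by rewrite /u1 /u2 /v1 /v2; ring.
(* Cramer's rule for the homogeneous system [du], [dv]. *)
have d10 : d1 = 0.
  apply: (mulIf det0); rewrite mul0r.
  transitivity (v2 * (d1 * u1 + d2 * u2) - u2 * (d1 * v1 + d2 * v2)).
    by ring.
  by rewrite du dv !mulr0 subr0.
have d20 : d2 = 0.
  apply: (mulIf det0); rewrite mul0r.
  transitivity (u1 * (d1 * v1 + d2 * v2) - v1 * (d1 * u1 + d2 * u2)).
    by ring.
  by rewrite du dv !mulr0 subr0.
have ex := subr0_eq d10; have ey := subr0_eq d20.
apply: circle_eq => /=; first by rewrite ex ey.
apply/eqP; rewrite -(eqrXn2 (n := 2))// ?ltW// ?circumradius_gt0//.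
by rewrite -CA -DA ex ey.
Qed.

End right_triangle.

(** * Area of a disc *)

Section disc_area.
Context (R : realType).
Notation mu := (@lebesgue_measure R).

(** The case distinction matters: the square root of a negative number is 0, so beyond the disc the
    interval would be a single point instead of empty. *)
Lemma xsection_disc (C : circle R) (x : R) :
  xsection (disc C) x =
  if `|x - (center C).1| <= radius C then
    let h := Num.sqrt (radius C ^+ 2 - (x - (center C).1) ^+ 2) in
    [set` `[(center C).2 - h, (center C).2 + h]]
  else set0.
Proof.
case: C => -[p q] r r0 /=.
have E y : (xsection (disc (Circle (p, q) r0)) x) y =
   (`|y - q| ^+ 2 <= r ^+ 2 - (x - p) ^+ 2) :> Prop.
  rewrite /xsection/disc/= in_setE/= edist_leP ?(ltW r0)//=.
  by rewrite lerBrDl (distrC y) real_normK ?num_real// -(opprB p x) sqrrN.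
have H : (`|x - p| <= r) = (0 <= r ^+ 2 - (x - p) ^+ 2).
  by rewrite subr_ge0 -[in RHS](real_normK (num_real (x - p)))
    ler_pXn2r// nnegrE// ltW.
rewrite H; apply/seteqP; split=> y; rewrite E.
  move=> h; case: ifPn => [h0|]; last first.
    by move/negP; apply; apply: le_trans h; exact: sqr_ge0.
  rewrite /= in_itv/= -ler_distl -ler_sqrt in h *.
    by rewrite sqrtr_sqr normr_id in h.
  by [].
case: ifPn => [h0|//].
rewrite /= in_itv/= -ler_distl => h.
by rewrite -[leRHS]sqr_sqrtr// ler_pXn2r// nnegrE// sqrtr_ge0.
Qed.

Lemma integral_chord_length (r p : R) : 0 < r ->
  (\int[mu]_(x in [set` `[p - r, p + r]%R])
     (2 * Num.sqrt (r ^+ 2 - (x - p) ^+ 2))%:E)%E = (pi * r ^+ 2)%:E.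
Proof.
move=> r0.
pose F (t : R) := p + r * sin t.
have dF (t : R) : is_derive t 1 F (r * cos t).
  rewrite /F; apply: is_derive_eq; rewrite /GRing.scale/=; ring.
have F' : derive1 F = fun t => r * cos t.
  by apply/funext => t; rewrite derive1E derive_val.
have cF' : continuous (derive1 F).
  move=> t; rewrite F'; apply: cvgM; [exact: cvg_cst|exact: continuous_cos].
have cF : continuous F.
  move=> t; apply: cvgD; first exact: cvg_cst.
  by apply: cvgM; [exact: cvg_cst|exact: continuous_sin].
have pi2 : - (pi / 2) < pi / 2 :> R.
  by have := pi_gt0 R; lra.
pose G (x : R) := 2 * Num.sqrt (r ^+ 2 - (x - p) ^+ 2).
have -> : p - r = F (- (pi / 2)) by rewrite /F sinN sin_pihalf; ring.
have -> : p + r = F (pi / 2) by rewrite /F sin_pihalf; ring.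
rewrite (@integration_by_substitution_increasing R F G _ _ (ltW pi2)).
(* The substituted integrand is [2 * r ^+ 2 * cos t ^+ 2], and [t + sin t * cos t] has derivative 1
   + cos^2 t - sin^2 t = 2 cos^2 t. *)
- pose H (t : R) := r ^+ 2 * (t + sin t * cos t).
  pose h (t : R) := 2 * r ^+ 2 * cos t ^+ 2.
  have dH (t : R) : is_derive t 1 H (h t).
    rewrite /H; apply: is_derive_eq; rewrite /h/GRing.scale/=.
    by have := cos2Dsin2 t; nra.
  transitivity (\int[mu]_(t in [set` `[- (pi / 2), pi / 2]%R]) (h t)%:E)%E.
    apply: eq_integral => t; rewrite inE/= in_itv/= => tI; congr (_ %:E).
    rewrite F'.
    change (2 * Num.sqrt (r ^+ 2 - (F t - p) ^+ 2) * (r * cos t) = h t).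
    have -> : r ^+ 2 - (F t - p) ^+ 2 = (r * cos t) ^+ 2.
      by rewrite exprMn cos2sin2 /F; ring.
    (* The cosine is nonnegative between [- (pi / 2)] and [pi / 2], so the root is [r * cos t]
       itself. *)
    rewrite sqrtr_sqr ger0_norm; first by rewrite /h; ring.
    by rewrite mulr_ge0 ?(ltW r0)// cos_ge0_pihalf.
  rewrite (@continuous_FTC2 R h H _ _ pi2).
  + rewrite -EFinB; congr (_%:E).
    by rewrite /H cosN cos_pihalf; field.
  + apply: continuous_subspaceT => t; rewrite /h.
    apply: cvgM; first exact: cvg_cst.
    by apply: (@cvgM R R); exact: continuous_cos.
  + split=> [t _|  | ]; first exact: ex_derive.
    * apply: cvg_at_right_filter.
      by apply/differentiable_continuous/derivable1_diffP.
    * apply: cvg_at_left_filter.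
      by apply/differentiable_continuous/derivable1_diffP.
  + by move=> t _; rewrite derive1E derive_val.
- move=> x y xI yI xy; rewrite /F ltrD2l ltr_pM2l// ltr_sin//.
- by move=> t _; exact: cF'.
- apply/cvg_ex; exists (derive1 F (- (pi / 2))).
  by apply: cvg_at_right_filter; exact: cF'.
- apply/cvg_ex; exists (derive1 F (pi / 2)).
  by apply: cvg_at_left_filter; exact: cF'.
- split=> [t _|  | ]; first exact: ex_derive.
  + by apply: cvg_at_right_filter; exact: cF.
  + by apply: cvg_at_left_filter; exact: cF.
- apply: continuous_subspaceT => t; rewrite /G.
  apply: cvgM; first exact: cvg_cst.
  apply: (@continuous_comp _ _ _ (fun t : R => r ^+ 2 - (t - p) ^+ 2));
    last exact: sqrt_continuous.
  apply: cvgB; first exact: cvg_cst.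
  apply: (@cvgM R R); (apply: cvgB; [exact: cvg_id|exact: cvg_cst]).
Qed.

(** The product measure is by definition the integral of the measures of the vertical sections, here
    the chords. *)
Lemma area_disc (C : circle R) : area (disc C) = (pi * radius C ^+ 2)%:E.
Proof.
have r0 := radius_gt0 C.
rewrite -(integral_chord_length (center C).1 r0) integral_mkcond.
rewrite /area /product_measure1/=; apply: eq_integral => x _ /=.
rewrite xsection_disc patchE mem_setE in_itv/= -ler_distl.
case: ifPn => [_|_]; last by rewrite measure0.
rewrite lebesgue_measure_itv/= lte_fin.
set h := Num.sqrt _.
have := sqrtr_ge0 (radius C ^+ 2 - (x - (center C).1) ^+ 2); rewrite -/h.
case: ifPn => [_ _|]; first by rewrite -EFinB; congr (_%:E); ring.
(* The degenerate chord: [h] is 0, so the measure 0 still equals [2 * h]. *)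
by rewrite -leNgt => h1 h2; congr (_%:E); lra.
Qed.

End disc_area.

(** * Bounds for the sine *)

Section sin_bounds.
Context {R : realType}.
Implicit Type x : R.

(** Both bounds below come from this mean value point: [cos c] is at most 1, and at least [cos x] as
    long as [x] is at most [pi]. *)
Lemma sin_mvt x : 0 < x -> exists2 c, 0 < c < x & sin x = cos c * x.
Proof.
move=> x0; have csin : {within `[0, x], continuous (@sin R)}.
  by apply: continuous_subspaceT; exact: continuous_sin.
have [c] := MVT x0 (fun t _ => is_derive_sin t) csin.
by rewrite in_itv sin0 !subr0 => c0x ->; exists c.
Qed.

Lemma norm_sin_le x : 0 < x -> `|sin x| <= x.
Proof.
move=> x0; have [c _ ->] := sin_mvt x0.
by rewrite normrM (gtr0_norm x0) ler_piMl ?cos_max// ltW.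
Qed.

Lemma mul_cos_le_sin x : 0 < x <= pi -> x * cos x <= sin x.
Proof.
move=> /andP[x0 xpi]; have [c /andP[c0 cx] ->] := sin_mvt x0.
have cpi : c <= pi := le_trans (ltW cx) xpi.
by rewrite mulrC ler_pM2r// ltW// ltr_cos// in_itv/= ?xpi ?cpi andbT ltW.
Qed.

End sin_bounds.

(** * Parametrization and perimeter of a circle *)

Section circle_param.
Context {R : realType}.
Variable C : circle R.
Let r := radius C.
Let r0 : 0 < r := radius_gt0 C.
Let r_ge0 : 0 <= r := ltW r0.

Definition circle_param (t : R) : R * R :=
  ((center C).1 + r * cos t, (center C).2 + r * sin t).

Lemma continuous_circle_param : continuous circle_param.
Proof.
move=> t.
have cC : (center C).1 + r * cos s @[s --> t] --> (center C).1 + r * cos t.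
  apply: cvgD; first exact: cvg_cst.
  by apply: cvgM; [exact: cvg_cst|exact: continuous_cos].
have cS : (center C).2 + r * sin s @[s --> t] --> (center C).2 + r * sin t.
  apply: cvgD; first exact: cvg_cst.
  by apply: cvgM; [exact: cvg_cst|exact: continuous_sin].
exact: cvg_pair cC cS.
Qed.

Lemma edist_circle_param s t :
  edist (circle_param s) (circle_param t) = 2 * r * `|sin ((t - s) / 2)|.
Proof.
apply/edist_eqP; first by rewrite mulr_ge0// mulr_ge0.
rewrite exprMn real_normK ?num_real//=.
(* In terms of the half sum [u] and the half difference [v], the addition formulas leave [u] only in
   the factor cos^2 u + sin^2 u. *)
have [u [v [-> ->]]] : exists u v, s = u - v /\ t = u + v.
  by exists ((t + s) / 2), ((t - s) / 2); split; field.
have -> : (u + v - (u - v)) / 2 = v by field.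
rewrite cosB sinB cosD sinD.
transitivity ((2 * r) ^+ 2 * sin v ^+ 2 * (cos u ^+ 2 + sin u ^+ 2)).
  by ring.
by rewrite cos2Dsin2 mulr1.
Qed.

Lemma circle_param_inj : {in `[(- pi), pi[ &, injective circle_param}.
Proof.
move=> s t; rewrite !in_itv/= => /andP[ps sp] /andP[pt tp] st.
wlog le_st : s t ps sp pt tp st / s <= t.
  by move=> H; have [|/ltW] := leP s t; [exact: H|move=> ?; apply/esym/H].
apply/eqP/negPn/negP => neq_st.
have lt_st : s < t by rewrite lt_neqAle neq_st.
(* Half the difference lies strictly between 0 and [pi], so the chord between distinct parameters
   cannot vanish. *)
have : 0 < sin ((t - s) / 2) by apply: sin_gt0_pi; lra.
move=> /gt_eqF/negP; apply; rewrite -normr_eq0.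
have := edist_circle_param s t.
rewrite st {1}/edist !subrr expr0n/= addr0 sqrtr0 => /esym/eqP.
by rewrite mulf_eq0 mulf_eq0 pnatr_eq0 (gt_eqF r0).
Qed.

Lemma circle_param_image : circle_param @` `[(- pi), pi] = circle_set C.
Proof.
apply/seteqP; split => [_ [t _ <-]|[x y]].
  apply/(edist_eqP (ltW r0)) => /=; rewrite -[RHS]mulr1 -(cos2Dsin2 t).
  by rewrite /r; ring.
move/(edist_eqP (ltW r0)) => /=; rewrite -/r.
set p := (center C).1; set q := (center C).2 => pq.
pose u := (x - p) / r; pose v := (y - q) / r.
have uv : u ^+ 2 + v ^+ 2 = 1.
  have r2 : r ^+ 2 != 0 by rewrite expf_neq0 ?gt_eqF.
  transitivity (((p - x) ^+ 2 + (q - y) ^+ 2) / r ^+ 2);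
    last by rewrite pq divff.
  by rewrite /u /v; field; rewrite gt_eqF.
have v2 : v ^+ 2 = 1 - u ^+ 2 by rewrite -uv; ring.
have u1 : -1 <= u <= 1.
  rewrite -ler_norml -(@expr_le1 _ 2)// real_normK ?num_real//.
  by rewrite -subr_ge0 -v2 sqr_ge0.
have uI : u \in `[(-1), 1]%R by rewrite in_itv.
have xE : x = p + r * u by rewrite /u; field; rewrite gt_eqF.
have yE : y = q + r * v by rewrite /v; field; rewrite gt_eqF.
have au := acos_ge0 u1; have apu := acos_lepi u1.
have sin_acos_u : sin (acos u) = `|v| by rewrite sin_acos// -v2 sqrtr_sqr.
(* [acos] takes values in [0, pi] and so reaches the upper half of the circle; the lower half needs
   the opposite angle. *)
have [v0|v0] := leP 0 v.
- exists (acos u).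
    by rewrite /= in_itv/= apu (le_trans _ au)// oppr_le0 pi_ge0.
  by rewrite /circle_param acosK// sin_acos_u ger0_norm// -xE -yE.
- exists (- acos u).
    by rewrite /= in_itv/= lerN2 apu (le_trans _ (pi_ge0 R))// oppr_le0.
  by rewrite /circle_param cosN sinN acosK// sin_acos_u ltr0_norm// opprK -xE -yE.
Qed.

Lemma polygonal_length_circle_le (a b : R) (s : seq R) : itv_partition a b s ->
  polygonal_length circle_param a s <= r * (b - a).
Proof.
move=> [/(pathP a) sp /eqP <-]; rewrite (last_nth a).
(* Writing [b - a] as the telescoping sum of the steps allows each chord to be compared with its own
   arc. *)
have /= <- := telescope_sumr (nth a (a :: s)) (leq0n (size s)).
rewrite mulr_sumr /polygonal_length big_nat_cond [leRHS]big_nat_cond.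
apply: ler_sum => i /andP[/andP[_ /sp ilt] _]; rewrite edist_circle_param.
have := @norm_sin_le R ((nth a s i - nth a (a :: s) i) / 2).
rewrite divr_gt0 ?subr_gt0//= => /(_ isT) H.
rewrite [leRHS](_ : _ = 2 * r * ((nth a s i - nth a (a :: s) i) / 2));
  last by field.
by rewrite ler_wpM2l// mulr_ge0.
Qed.

(** A partition lists only the points after its left end, hence [i.+1] in [s]; each of the [m.+1]
    chords spans the angle [2 * pi / m.+1%:R]. *)
Lemma regular_polygonal_length (m : nat) :
  let s := mkseq (fun i => - pi + 2 * pi * i.+1%:R / m.+1%:R) m.+1 in
  itv_partition (- pi) pi s /\
  polygonal_length circle_param (- pi) s = 2 * r * m.+1%:R * sin (pi / m.+1%:R).
Proof.
set f := fun i : nat => - pi + 2 * pi * i%:R / m.+1%:R : R.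
move=> s; have ss : size s = m.+1 by rewrite size_mkseq.
have m0 : m.+1%:R != 0 :> R by rewrite pnatr_eq0.
have f0 : f 0 = - pi by rewrite /f mulr0 mul0r addr0.
have nthS i : (i < m.+1)%N -> nth (- pi) s i = f i.+1.
  by move=> im; rewrite nth_mkseq.
have nths i : (i < m.+2)%N -> nth (- pi) (- pi :: s) i = f i.
  by case: i => [_|i im]; rewrite ?f0//= nthS.
have fS i : f i.+1 - f i = 2 * (pi / m.+1%:R).
  by rewrite /f -natr1; field.
have pm0 : 0 < pi / m.+1%:R :> R by rewrite divr_gt0 ?pi_gt0.
split.
  split.
    apply/(pathP (- pi)) => i; rewrite ss => im.
    rewrite nths ?nthS//; last exact: ltnW.
    by rewrite -subr_gt0 fS mulr_gt0.
  rewrite (last_nth (- pi)) ss nths// /f.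
  by apply/eqP; field.
rewrite /polygonal_length ss big_nat_cond.
rewrite (eq_bigr (fun=> 2 * r * sin (pi / m.+1%:R))).
  by rewrite -big_nat_cond sumr_const_nat subn0 -[LHS]mulr_natr; ring.
move=> i /andP[/andP[_ im] _].
rewrite edist_circle_param !nths//; last exact: ltnW.
rewrite fS [X in sin X]mulrC mulKf ?pnatr_eq0// ger0_norm// sin_ge0_pi//.
by rewrite ltW//= ler_pdivrMr// ler_peMr ?pi_ge0// ler1n.
Qed.

Lemma arc_length_circle_param :
  arc_length (- pi) pi circle_param = (2 * pi * r)%:E.
Proof.
apply/eqP; rewrite eq_le; apply/andP; split.
  apply: ge_ereal_sup => _ [s /polygonal_length_circle_le sp <-].
  by rewrite lee_fin (le_trans sp)// le_eqVlt; apply/orP; left; apply/eqP; ring.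
have pin : (pi / n.+1%:R : R) @[n --> \oo] --> (0 : R).
  rewrite -(mulr0 pi); apply: cvgM; first exact: cvg_cst.
  exact: cvg_harmonic.
(* These numbers tend to the claimed length, and each is at most the length of a regular polygon,
   hence at most the supremum. *)
have cpin : ((2 * pi * r * cos (pi / n.+1%:R))%:E : \bar R) @[n --> \oo] -->
    (2 * pi * r)%:E.
  apply: cvg_EFin; first by near=> n.
  have := cvg_comp _ _ pin (@continuous_cos R 0); rewrite cos0 => cos1.
  by rewrite -[X in _ --> X]mulr1; apply: cvgM; [exact: cvg_cst|exact: cos1].
apply: (cvge_to_le cpin); near=> n.
have [sp sl] := regular_polygonal_length n.
apply: (@le_trans _ _ (polygonal_length circle_param (- pi) _)%:E); last first.
  by apply: ereal_sup_ubound; eexists; [exact: sp|].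
rewrite sl lee_fin.
have pm0 : 0 < pi / n.+1%:R :> R by rewrite divr_gt0 ?pi_gt0.
have n0 : n.+1%:R != 0 :> R by rewrite pnatr_eq0.
(* This isolates [x * cos x] at [x = pi / n.+1%:R], to be compared with the [sin x] of the
   polygon. *)
rewrite [leLHS](_ : _ = 2 * r * n.+1%:R * (pi / n.+1%:R * cos (pi / n.+1%:R)));
  last by field.
rewrite ler_wpM2l//; first by rewrite mulr_ge0// mulr_ge0.
rewrite mul_cos_le_sin// pm0/=.
by rewrite ler_pdivrMr// ler_peMr ?pi_ge0// ler1n.
Unshelve. all: by end_near. Qed.

Lemma has_perimeter_circle : has_perimeter (circle_set C) (2 * pi * r)%:E.
Proof.
exists (- pi), pi, circle_param; split; last exact: arc_length_circle_param.
split.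
- by have := pi_gt0 R; lra.
- exact/continuous_subspaceT/continuous_circle_param.
- by rewrite /circle_param cosN sinN sinpi oppr0.
- exact: circle_param_inj.
- exact: circle_param_image.
Qed.

End circle_param.

Theorem theorem5p1 (R : realType) (n : nat) (hn : (1 <= n)%N)
    (A P B : R * R)
    (hT : right_triangle A P B (Num.sqrt (fib n)%:R) (Num.sqrt (fib n.+1)%:R)
            (Num.sqrt (fib n.+2)%:R)) :
  exists C : circle R,
    unique (circumscribed A B P) C /\
    area (disc C) = (pi / 4 * (fib n.+2)%:R)%:E /\
    has_perimeter (circle_set C) (pi * Num.sqrt (fib n.+2)%:R)%:E.
Proof.
exists (circumcircle hT); split; [split|split].
- exact: circumscribed_circumcircle.
- exact: circumscribed_unique.
(* The radius is half the hypotenuse, so its square is a quarter of [fib n.+2]. *)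
- by rewrite area_disc/= expr_div_n sqr_sqrtr ?ler0n//; congr (_%:E); field.
- have := has_perimeter_circle (circumcircle hT).
  by congr has_perimeter; congr (_%:E) => /=; field.
Qed.
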